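(* There exists a countable ($T_1$) topological space $X$ with exactly one non-isolated point $p$ such that $X$ is productively countably tight at $p$, but player One has a winning strategy in the game $\mathsf{G}_{\mathrm{fin}}(\Omega_p,\Omega_p)$ on $X$.
   Context: All topological spaces are assumed to be $T_1$. For a space $X$ and $x\in X$, let $\Omega_x=\{A\subseteq X: x\in\overline{A}\}$. A space $X$ is countably tight at $x$ if every $A\in\Omega_x$ has a countable subset $C$ with $x\in\overline{C}$. A space $X$ is productively countably tight at $x\in X$ if, for every topological space $Y$ that is countably tight at a point $y\in Y$, the product $X\times Y$ is countably tight at $(x,y)$. The game $\mathsf{G}_{\mathrm{fin}}(\Omega_x,\Omega_x)$ on $X$ is played by One and Two: in each inning $n\in\omega$, One chooses $A_n\in\Omega_x$, and then Two chooses a finite subset $F_n\subseteq A_n$. Two wins if $\bigcup_{n\in\omega}F_n\in\Omega_x$; otherwise One wins. *)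

(* Defs.v *)
From mathcomp Require Import all_boot all_order.
From mathcomp Require Import all_classical topology.

Set Implicit Arguments.
Unset Strict Implicit.
Unset Printing Implicit Defensive.

Local Open Scope classical_set_scope.

Definition Omega (X : topologicalType) (x : X) : set (set X) :=
  [set A | closure A x].

Definition countably_tight_at (X : topologicalType) (x : X) : Prop :=
  forall A, Omega x A ->
    exists C : set X, [/\ C `<=` A, countable C & Omega x C].

(* All spaces are T1 by convention, so the test spaces [Y] are T1 as well.
   [topologicalType] does not require a distinguished point. *)
Definition productively_countably_tight_at (X : topologicalType) (x : X) :
    Prop :=
  forall (Y : topologicalType) (y : Y),
    accessible_space Y -> countably_tight_at y ->
    countably_tight_at ((x, y) : (X * Y)%type).

(* The game G_fin(A, B). A strategy of One maps the finite sequence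
   [:: F 0; ...; F n.-1] of the previous moves of Two to One's move in inning
   n. It is a total function, with legal values also at positions that are not
   reachable; any strategy defined only at legal positions extends to such a
   function, since no strategy exists when A is empty. *)
Definition Gfin_strategy_One (T : Type) (A : set (set T))
    (sigma : seq (set T) -> set T) : Prop :=
  forall s, A (sigma s).

Definition Gfin_play_against (T : Type) (sigma : seq (set T) -> set T)
    (F : nat -> set T) : Prop :=
  forall n, finite_set (F n) /\ F n `<=` sigma (mkseq F n).

Definition One_has_winning_strategy_Gfin (T : Type) (A B : set (set T)) :
    Prop :=
  exists sigma : seq (set T) -> set T,
    Gfin_strategy_One A sigma /\
    forall F : nat -> set T,
      Gfin_play_against sigma F -> ~ B (\bigcup_n F n).

(* Main.v *)
(** The space is the tree of finite sequences of naturals, with [p] the root and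
every other node isolated. One always plays all children of a node [s]; from
Two's finite answer she extracts a bound [k] on the children chosen and moves on
to the node [rcons s k]. What Two collects along the branch [f] built in this
way lies in [fan f], the children [rcons (f|n) k] with [k <= f n]. The
neighbourhoods of [p] are the complements of sets covered by finitely many fans,
so One wins.

For productivity, take [(p, y)] in the closure of [A] and call [S] positive if
the part of [A] over [S] accumulates at [y] in the second coordinate. If the
positive singletons are not covered by finitely many fans, countably many points
of [A] over them suffice. Otherwise let [K] be the set of branches all of whose
cones are positive. If [K] is infinite, countable witnesses for all positive
cones suffice: finitely many fans miss a whole cone around some branch in [K].
If [K] is finite, take a countable witness outside the positive singletons and
the fans of [K]: every other fan lies, up to finitely many points, in a cone
that is not positive. *)

From HB Require Import structures.
Require Import Defs.
From mathcomp Require Import all_boot all_order.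
From mathcomp Require Import all_classical topology.

Set Implicit Arguments.
Unset Strict Implicit.

Local Open Scope classical_set_scope.

(** * Finite unions and bounds *)

Lemma finite_bigcup_ind {I T : Type} (P : set (set T)) (D : set I)
    (F : I -> set T) :
  P set0 -> (forall E E', P E -> P E' -> P (E `|` E')) ->
  finite_set D -> (forall i, D i -> P (F i)) -> P (\bigcup_(i in D) F i).
Proof.
move=> P0 PU /(finite_seqP (T := {classic I}))[s ->].
elim: s => [|i s IHs] PF.
  by rewrite (_ : \bigcup_(i in _) _ = set0) // -subset0 => x [].
have -> : \bigcup_(j in [set` i :: s]) F j = F i `|` \bigcup_(j in [set` s]) F j.
  apply/seteqP; split=> x /=.
    move=> [j /=]; rewrite inE => /orP[/eqP -> Fx|js Fx]; [by left|right].
    by exists j.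
  move=> [Fx|[j /= js Fx]]; first by exists i; rewrite //= inE eqxx.
  by exists j; rewrite //= inE js orbT.
apply: PU; first by apply: PF; rewrite /= inE eqxx.
by apply: IHs => j /= js; apply: PF; rewrite /= inE js orbT.
Qed.

Lemma finite_set_nat_bounded (S : set nat) :
  finite_set S -> exists N, forall n, S n -> n <= N.
Proof.
move=> /finite_seqP[s ->]; exists (\max_(i <- s) i) => n /= ns.
exact: (leq_bigmax_seq (P := xpredT) (F := id)).
Qed.

Lemma finite_fun_bounded {I : Type} (h : I -> nat) (D : set I) :
  finite_set D -> exists N, forall i, D i -> h i <= N.
Proof.
move=> /(finite_image h)/finite_set_nat_bounded[N hN].
by exists N => i Di; apply: hN; exists i.
Qed.

(** * Accumulation in the second coordinate *)

Section Clustering.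
Context {X : Type} {Y : topologicalType} (y : Y).

Definition clusters_at (S : set (X * Y)) : Prop := closure (snd @` S) y.

Lemma clusters_atS (S S' : set (X * Y)) :
  S `<=` S' -> clusters_at S -> clusters_at S'.
Proof. by move=> SS'; apply: closure_subset; apply: image_subset. Qed.

Lemma clusters_atU (S S' : set (X * Y)) :
  clusters_at (S `|` S') -> clusters_at S \/ clusters_at S'.
Proof. by rewrite /clusters_at image_setU closureU. Qed.

Lemma not_clusters0 : ~ clusters_at set0.
Proof. by rewrite /clusters_at image_set0 closure0. Qed.

Lemma not_clusters_bigcup {I : Type} (D : set I) (F : I -> set (X * Y)) :
  finite_set D -> (forall i, D i -> ~ clusters_at (F i)) ->
  ~ clusters_at (\bigcup_(i in D) F i).
Proof.
apply: (finite_bigcup_ind (P := fun S => ~ clusters_at S)).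
  exact: not_clusters0.
by move=> E E' nE nE' /clusters_atU[].
Qed.

Hypothesis y_tight : countably_tight_at y.

Lemma clusters_at_countable (S : set (X * Y)) : clusters_at S ->
  exists C, [/\ C `<=` S, countable C & clusters_at C].
Proof.
move=> /y_tight[D [DS cD Dy]].
have /choice[h hP] : forall v, exists z, D v -> S z /\ z.2 = v.
  move=> v; have [Dv|nDv] := pselect (D v).
    by have [z Sz zv] := DS _ Dv; exists z.
  (* Outside [D] any pair serves as default; one exists because [D] is nonempty, [y] being in its
     closure. *)
  have [v0 [Dv0 _]] := Dy setT filterT.
  by have [z _ _] := DS _ Dv0; exists z.
exists (h @` D); split.
- by move=> _ [v Dv <-]; have [] := hP _ Dv.
- by apply: sub_countable cD; exact: card_image_le.
- apply: closure_subset Dy => v Dv; exists (h v); first by exists v.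
  by have [] := hP _ Dv.
Qed.

Lemma clusters_at_countable_family {I : countType} (S : I -> set (X * Y)) :
  exists C, [/\ C `<=` \bigcup_i S i, countable C &
    forall i, clusters_at (S i) -> clusters_at (S i `&` C)].
Proof.
have /choice[C CP] : forall i, exists C,
    [/\ C `<=` S i, countable C & clusters_at (S i) -> clusters_at C].
  move=> i; have [Si|nSi] := pselect (clusters_at (S i)).
    by have [C [CS cC Cy]] := clusters_at_countable Si; exists C.
  by exists set0; split=> //; exact: countable0.
exists (\bigcup_i C i); split.
- by move=> z [i _ Cz]; exists i => //; have [+ _ _] := CP i; apply.
- by apply: bigcup_countable => // i _; have [] := CP i.
- move=> i Si; have [CS _ /(_ Si)] := CP i.
  by apply: clusters_atS => z Cz; split; [exact: CS|exists i].
Qed.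

End Clustering.

(** * Fans, thin sets and cones *)

Definition fan (f : nat -> nat) : set (seq nat) :=
  [set x | exists n k, k <= f n /\ x = rcons (mkseq f n) k].

Definition thin (E : set (seq nat)) : Prop :=
  exists2 G : set (nat -> nat), finite_set G & E `<=` \bigcup_(f in G) fan f.

Definition cone (s : seq nat) : set (seq nat) :=
  [set t | size s < size t /\ take (size s) t = s].

Lemma not_fan_nil f : ~ fan f [::].
Proof. by move=> [n [k [_ /esym/(congr1 size)]]]; rewrite size_rcons. Qed.

Lemma not_thin_nil E : thin E -> ~ E [::].
Proof. by move=> [G _ sE] /sE[f _]; exact: not_fan_nil. Qed.

Lemma thin0 : thin set0.
Proof. by exists set0 => // x []. Qed.

Lemma thinS E E' : E `<=` E' -> thin E' -> thin E.
Proof. by move=> sE [G fG sE']; exists G => //; exact: subset_trans sE'. Qed.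

Lemma thinU E E' : thin E -> thin E' -> thin (E `|` E').
Proof.
move=> [G fG sE] [G' fG' sE']; exists (G `|` G'); first by rewrite finite_setU.
by rewrite bigcup_setU; apply: setUSS.
Qed.

Lemma thin_bigcup_fan (G : set (nat -> nat)) :
  finite_set G -> thin (\bigcup_(f in G) fan f).
Proof. by exists G. Qed.

Lemma thin_fan f : thin (fan f).
Proof. by exists [set f] => //; rewrite bigcup_set1. Qed.

(** A node [rcons t k] lies in the fan of the branch that reads off its own entries, since that
    branch takes the value [k] at [size t]. *)
Lemma thin_set1 x : x != [::] -> thin [set x].
Proof.
case/lastP: x => // t k _; apply: (thinS _ (@thin_fan (nth 0 (rcons t k)))).
move=> _ ->; exists (size t), k; rewrite nth_rcons ltnn eqxx; split=> //.
congr rcons; apply: (@eq_from_nth _ 0); rewrite ?size_mkseq // => i it.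
by rewrite nth_mkseq // nth_rcons it.
Qed.

(** Below level [n] the fan has finitely many points, by the bound [k <= f m]; all later ones extend
    [mkseq f n]. *)
Lemma fan_finite_cone (f : nat -> nat) n :
  exists2 H, finite_set H & fan f `<=` H `|` cone (mkseq f n).
Proof.
exists (\bigcup_(m in `I_n) (fun k => rcons (mkseq f m) k) @` `I_(f m).+1).
  by apply: bigcup_finite => // m _; exact: finite_image.
move=> _ [m [k [kf ->]]]; have [mn|nm] := ltnP m n.
  by left; exists m => //; exists k.
right; split; rewrite size_mkseq ?size_rcons ?size_mkseq //.
rewrite -cats1 takel_cat ?size_mkseq // /mkseq -map_take take_iota.
by rewrite (minn_idPl nm).
Qed.

Lemma fan_cone (f g : nat -> nat) n :
  fan f `&` cone (mkseq g n) !=set0 -> forall i, i < n -> f i = g i.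
Proof.
move=> [_ [[m [k [_ ->]]]] []]; rewrite size_rcons !size_mkseq ltnS => nm.
rewrite -cats1 takel_cat ?size_mkseq // /mkseq -map_take take_iota.
rewrite (minn_idPl nm) => fg i ilen.
by have := congr1 (nth 0 ^~ i) fg; rewrite /= !nth_mkseq.
Qed.

(** Each branch in [G] differs from [g] at some index; a prefix of [g] long enough to contain all
    these indices rules out every fan at once. *)
Lemma cone_avoids_fans (G : set (nat -> nat)) (g : nat -> nat) :
  finite_set G -> ~ G g ->
  exists n, cone (mkseq g n) `<=` ~` \bigcup_(f in G) fan f.
Proof.
move=> fG nGg.
have /choice[d dP] : forall f, exists i, f != g -> f i <> g i.
  move=> f; have [//|fg] := eqVneq f g; first by exists 0.
  apply: contrapT => nd; move/eqP: fg; apply; apply/funext => i.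
  by apply: contrapT => fgi; apply: nd; exists i.
have [N dN] := finite_fun_bounded d fG.
exists N.+1 => x gx [f Gf fx].
have fg : f != g by apply/eqP => fg; apply: nGg; rewrite -fg.
apply: (dP f fg); apply: (@fan_cone f g N.+1); first by exists x.
by rewrite ltnS; exact: dN.
Qed.

Lemma thick_countable {Y : topologicalType} (y : Y) (A : set (seq nat * Y)) :
  countably_tight_at y ->
  (forall E, thin E -> clusters_at y (A `&` fst @^-1` (~` E))) ->
  exists C, [/\ C `<=` A, countable C &
    forall E, thin E -> clusters_at y (C `&` fst @^-1` (~` E))].
Proof.
move=> y_tight A_thick.
pose P := [set x | clusters_at y (A `&` fst @^-1` [set x])].
have [thinP|nthinP] := pselect (thin P); last first.
  have [C [CA cC Cacc]] := clusters_at_countable_family y_tight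
    (fun x => A `&` fst @^-1` [set x]).
  exists C; split=> // [z /CA[x _ []] //|E thinE].
  (* As [P] is not thin, some positive node escapes [E], and [C] already accumulates over that
     single node. *)
  have [x Px nEx] : exists2 x, P x & ~ E x.
    apply: contrapT => nx; apply: nthinP; apply: thinS thinE => x Px.
    by apply: contrapT => nEx; apply: nx; exists x.
  apply: clusters_atS (Cacc x Px) => z [[_ /= zx] Cz]; split=> //=.
  by rewrite zx.
pose K := [set g | forall n,
  clusters_at y (A `&` fst @^-1` (cone (mkseq g n)))].
have [finK|infK] := pselect (finite_set K); last first.
  have [C [CA cC Cacc]] := clusters_at_countable_family y_tight
    (fun s => A `&` fst @^-1` (cone s)).
  exists C; split=> // [z /CA[x _ []] //|E [G fG sE]].
  have [g [Kg nGg]] := infinite_setN0 (infinite_setD infK fG).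
  have [n avoid] := cone_avoids_fans fG nGg.
  apply: clusters_atS (Cacc _ (Kg n)) => z [[_ /avoid/= nz] Cz]; split=> //=.
  by move=> /sE.
(* Removing a thin set keeps the accumulation, so [C] can be chosen off [P] and off all fans of
   [K]. *)
have /(A_thick _)/(clusters_at_countable y_tight)[C [CA cC Cacc]] :
    thin (P `|` \bigcup_(f in K) fan f).
  by apply: thinU => //; exact: thin_bigcup_fan.
exists C; split=> // [z /CA[]//|E [G fG sE]].
have : clusters_at y (C `&` fst @^-1` (~` E)) \/
       clusters_at y (\bigcup_(g in G) (C `&` fst @^-1` (fan g))).
  apply: clusters_atU; apply: clusters_atS Cacc => z Cz.
  have [/sE[g Gg gz]|nEz] := pselect (E z.1); last by left.
  by right; exists g.
(* The second alternative is impossible: [C] does not accumulate over any single fan. *)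
move=> [//|]; apply: contraPP => _; apply: not_clusters_bigcup => // g _.
have [Kg|] := pselect (K g).
  rewrite (_ : _ `&` _ = set0); first exact: not_clusters0.
  by rewrite -subset0 => z [/CA[_ /= nz] gz]; apply: nz; right; exists g.
(* A cone of [g] without accumulation covers the fan up to the finite set [H]; since [C] avoids [P],
   only nodes of [H] that are not positive remain. *)
move=> /existsNP[n nacc]; have [H finH sH] := fan_finite_cone g n.
have : ~ clusters_at y (\bigcup_(x in H `\` P) (A `&` fst @^-1` [set x])).
  by apply: not_clusters_bigcup => [|x []//]; exact: finite_setD.
move=> nacc'.
have sub : C `&` fst @^-1` (fan g) `<=`
    \bigcup_(x in H `\` P) (A `&` fst @^-1` [set x]) `|`
    A `&` fst @^-1` (cone (mkseq g n)).
  move=> z [/CA[Az /= nz] /sH[Hz|?]]; last by right.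
  by left; exists z.1 => //; split=> // Pz; apply: nz; left.
by move=> /(clusters_atS sub)/clusters_atU[].
Qed.

(** * The topology on the tree *)

Definition fan_space : Type := seq nat.

HB.instance Definition _ := Choice.on fan_space.

Definition fan_open : set (set fan_space) := [set U | U [::] -> thin (~` U)].

Lemma fan_openT : fan_open setT.
Proof. by move=> _; rewrite setCT; exact: thin0. Qed.

Lemma fan_openI : setI_closed fan_open.
Proof. by move=> U V oU oV [/oU ? /oV ?]; rewrite setCI; exact: thinU. Qed.

Lemma fan_open_bigU (I : Type) (U : I -> set fan_space) :
  (forall i, fan_open (U i)) -> fan_open (\bigcup_i U i).
Proof.
move=> oU [i _ /oU]; apply: thinS; apply: subsetC; exact: bigcup_sup.
Qed.

HB.instance Definition _ := isOpenTopological.Build fan_space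
  fan_openT fan_openI fan_open_bigU.

Definition fan_point : fan_space := [::].

Lemma nbhs_fan_pointP (U : set fan_space) :
  nbhs fan_point U <-> U fan_point /\ thin (~` U).
Proof.
split=> [[V [oV Vp VU]]|[Up tU]]; last by exists U; split=> [_||].
by split; [exact: VU|exact: thinS (subsetC VU) (oV Vp)].
Qed.

Lemma nbhs_fan_pointC E : thin E -> nbhs fan_point (~` E).
Proof.
by move=> tE; apply/nbhs_fan_pointP; rewrite setCK; split=> //; exact: not_thin_nil.
Qed.

Lemma nbhs_fan_isolated (x : fan_space) : x != fan_point -> nbhs x [set x].
Proof. by move=> /eqP xp; exists [set x]; split=> // px; exfalso; exact: xp. Qed.

Lemma children_Omega s : Omega fan_point (range (rcons s) : set fan_space).
Proof.
move=> U /nbhs_fan_pointP[_ [G fG sU]].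
have [N GN] := finite_fun_bounded (fun f => f (size s)) fG.
(* The fans in [G] contain only children [rcons s k] with [k <= N]. *)
exists (rcons s N.+1); split; first by exists N.+1.
apply: contrapT => /sU[f Gf [n [k [kf]]]] /rcons_inj[sE kE].
have sn : size s = n by rewrite sE size_mkseq.
have fn : f n <= N by rewrite -sn GN.
by move: (leq_trans kf fn); rewrite -kE ltnn.
Qed.

Lemma fan_space_accessible : accessible_space fan_space.
Proof.
move=> x y xy; exists (~` [set y]); split.
- move=> /= py; rewrite setCK; apply: thin_set1.
  by apply/eqP => yp; apply: py; rewrite yp.
- by apply/mem_set => /= xy'; move: xy; rewrite xy' eqxx.
- by rewrite setCK; apply/mem_set.
Qed.

Lemma fan_space_isolatedC : ~` isolated [set: fan_space] = [set fan_point].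
Proof.
apply/seteqP; split=> [x nx|_ -> [_ [V]]] /=.
  apply: contrapT => /eqP xp; apply: nx; split; first exact: mem_set.
  by exists [set x]; rewrite ?setIT //; exact: nbhs_fan_isolated.
rewrite setIT => + VE; rewrite {}VE => /(children_Omega [::])[_ [[k _ <-]]].
by [].
Qed.

Lemma closure_fan_pointP {Y : topologicalType} (y : Y) (A : set (fan_space * Y)) :
  closure A (fan_point, y) <->
  forall E, thin E -> clusters_at y (A `&` fst @^-1` (~` E)).
Proof.
split=> [Ay E /nbhs_fan_pointC pE V yV|acc W [[U V] [/= pU yV] UVW]].
  have /Ay[z [Az [Ez Vz]]] : nbhs (fan_point, y) (~` E `*` V).
    by exists (~` E, V).
  by exists z.2; split=> //; exists z.
have /nbhs_fan_pointP[_ /acc/(_ V yV)] := pU.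
by rewrite setCK => -[_ [[z [Az Uz] <-] Vz]]; exists z; split=> //; apply: UVW.
Qed.

(** * Productive tightness and the game *)

Lemma fan_point_productively_tight :
  productively_countably_tight_at fan_point.
Proof.
move=> Y y _ y_tight A /closure_fan_pointP/(thick_countable y_tight).
by move=> [C [CA cC Cacc]]; exists C; split=> //; apply/closure_fan_pointP.
Qed.

Lemma fan_point_One_wins :
  One_has_winning_strategy_Gfin (Omega fan_point) (Omega fan_point).
Proof.
have /choice[b bP] : forall F : set fan_space,
    exists N, finite_set F -> forall x, F x -> last 0 x <= N.
  move=> F; have [fF|//] := pselect (finite_set F); last by exists 0.
  by have [N FN] := finite_fun_bounded (last 0) fF; exists N.
(* The bounds on Two's answers so far spell the node whose children One plays next. *)
exists (fun s => range (rcons (map b s))); split=> [s|F play].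
  exact: children_Omega.
(* The play follows the branch [b \o F], and the complement of its fan is a neighbourhood of the
   root missing all of Two's choices. *)
move=> /(_ _ (nbhs_fan_pointC (thin_fan (b \o F))))[x [[n _ Fx]]]; apply.
have [finF /(_ _ Fx)[k _ xE]] := play n.
exists n, k; split; last by rewrite -xE /mkseq -map_comp.
by have := bP _ finF _ Fx; rewrite -xE last_rcons.
Qed.

Theorem mainTheorem1 :
  exists (X : topologicalType) (p : X),
    [/\ accessible_space X,
        countable [set: X],
        ~` isolated [set: X] = [set p],
        productively_countably_tight_at p
      & One_has_winning_strategy_Gfin (Omega p) (Omega p)].
Proof.
exists fan_space, fan_point; split.
- exact: fan_space_accessible.
- exact: (countableP (T := seq nat)).
- exact: fan_space_isolatedC.
- exact: fan_point_productively_tight.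
- exact: fan_point_One_wins.
Qed.
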